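(* For every $n\geq 1$, \[\frac{g_n}{1+f_n}\leq\frac{e_n-1}{e_n}.\]
   Context: Let $p_1=2,p_2=3,p_3=5,\ldots$ be the prime numbers in increasing order. A numerical semigroup is an additively closed subset $S\subseteq\mathbb{N}$ with $0\in S$ and with finite complement in $\mathbb{N}$; the elements of $\mathbb{N}\setminus S$ are its gaps, the genus is the number of gaps, and (for $S\ne\mathbb{N}$) the Frobenius number is the largest gap. For $S^*=S\setminus\{0\}$ the atoms of $S$ are the elements of $S^*\setminus(S^*+S^* )$ (the unique minimal generating system), and the embedding dimension is the number of atoms. For $n\ge 1$ let $S_n$ be the numerical semigroup generated by all primes not less than $p_n$, and let $g_n$, $f_n$, $e_n$ be its genus, Frobenius number and embedding dimension, respectively. *)

(* Defs.v *)
From mathcomp Require Import all_boot all_order all_algebra finmap zify.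
From mathcomp Require Import boolp classical_sets cardinality.

Set Implicit Arguments.
Unset Strict Implicit.
Unset Printing Implicit Defensive.

Local Open Scope classical_set_scope.
Local Open Scope nat_scope.

Lemma next_prime_subproof m : exists p, prime p && (m < p).
Proof. by have [p mp pp] := prime_above m; exists p; rewrite pp. Qed.

Definition next_prime (m : nat) : nat := ex_minn (next_prime_subproof m).

(* Indexing starts at 1: nth_prime 1 = 2, nth_prime 2 = 3, nth_prime 3 = 5;
   nth_prime 0 = 0 is only the starting point of the iteration. *)
Definition nth_prime (n : nat) : nat := iter n next_prime 0.

Definition submonoid (A : set nat) : Prop :=
  A 0 /\ (forall x y, A x -> A y -> A (x + y)).

Record numerical_semigroup := NumericalSemigroup {
  ns_set :> set nat;
  ns_submonoid : submonoid ns_set;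
  ns_cofinite : finite_set (~` ns_set) }.

Section Invariants.
Variable S : numerical_semigroup.

Definition gaps : set nat := ~` S.

Definition genus : nat := #|` fset_set gaps|%fset.

(* This is the largest gap when S is not the whole of nat; the maximum over
   an empty set of gaps is 0. *)
Definition frobenius : nat := \max_(x <- fset_set gaps) x.

Definition nonzero_part : set nat := S `\ 0.

Definition atoms : set nat :=
  nonzero_part `\` [set x + y | x in nonzero_part & y in nonzero_part].

(* fset_set sends infinite sets to fset0; see finite_atoms. *)
Definition embdim : nat := #|` fset_set atoms|%fset.

Lemma finite_gaps : finite_set gaps.
Proof. exact: ns_cofinite. Qed.

Lemma gap_le_frobenius x : gaps x -> x <= frobenius.
Proof.
move=> gx; rewrite /frobenius; apply: (@leq_bigmax_seq _ _ xpredT id) => //.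
by rewrite in_fset_set ?inE //; exact: finite_gaps.
Qed.

Lemma gap_frobenius : gaps !=set0 -> gaps frobenius.
Proof.
move=> [x gx].
have mem y : (y \in fset_set gaps) = (y \in gaps).
  by rewrite in_fset_set //; exact: finite_gaps.
have x_in : x \in enum_fset (fset_set gaps) by rewrite mem inE.
suff: frobenius \in enum_fset (fset_set gaps) by rewrite mem inE.
rewrite /frobenius; have: enum_fset (fset_set gaps) != [::].
  by apply/eqP => e; rewrite e in x_in.
elim: (enum_fset (fset_set gaps)) => // a [|b s] IH _.
  by rewrite big_seq1 mem_head.
rewrite big_cons; case: (leqP a (\max_(j <- b :: s) j)) => _.
  by rewrite inE IH ?orbT.
exact: mem_head.
Qed.

Lemma finite_atoms : finite_set atoms.
Proof.
pose m := frobenius.+1.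
apply: (@sub_finite_set _ _ `I_(m + m).+1); last exact: finite_II.
move=> x [[Sx /= x0] nx] /=; rewrite ltnS leqNgt; apply/negP => mx; apply: nx.
have big y : frobenius < y -> ns_set S y.
  by move=> ly; apply: contrapT => /gap_le_frobenius; rewrite leqNgt ly.
have mltx : m <= x - m by rewrite leq_subRL; lia.
exists m; first by split => //; exact: big.
exists (x - m); last by rewrite subnKC //; lia.
by split; [exact: big | move=> /= e; move: mltx; rewrite e].
Qed.

End Invariants.

Definition primes_from (n : nat) : set nat :=
  [set q | prime q /\ nth_prime n <= q].

Definition generated_by_primes_from (n : nat) : set nat :=
  smallest submonoid (primes_from n).

Lemma generated_submonoid n : submonoid (generated_by_primes_from n).
Proof.
split; first by move=> A [[]].
by move=> x y Sx Sy A hA; have [[_ hD] _] := hA; apply: hD; [exact: Sx|exact: Sy].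
Qed.

Lemma generated_cofinite n : finite_set (~` generated_by_primes_from n).
Proof.
have [S0 SD] := generated_submonoid n.
have SM a x : generated_by_primes_from n x -> generated_by_primes_from n (a * x).
  by move=> Sx; elim: a => [|a IH]; rewrite ?mul0n // mulSn; apply: SD.
have [p np pp] := prime_above (nth_prime n).
have [q pq qq] := prime_above p.
have gen r : prime r -> nth_prime n <= r -> generated_by_primes_from n r.
  by move=> pr nr A [_]; apply.
have Sp := gen _ pp (ltnW np).
have Sq := gen _ qq (ltnW (ltn_trans np pq)).
have cpq : coprime p q.
  by rewrite prime_coprime // dvdn_prime2 // neq_ltn pq.
apply: (@sub_finite_set _ _ `I_(p * q)); last exact: finite_II.
move=> x nx /=; rewrite ltnNge; apply/negP => lx; apply: nx.
pose y := chinese p q x 0 %% (p * q).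
have ltyx : y <= x.
  by apply: leq_trans lx; apply: ltnW; rewrite ltn_mod muln_gt0 !prime_gt0.
have qy : q %| y.
  by rewrite /dvdn modn_dvdm ?dvdn_mull // chinese_modr // mod0n.
have px : p %| x - y.
  by rewrite -eqn_mod_dvd // modn_dvdm ?dvdn_mulr // chinese_modl.
have -> : x = (x - y) %/ p * p + y %/ q * q by rewrite !divnK // subnK.
by apply: SD; exact: SM.
Qed.

Definition prime_semigroup (n : nat) : numerical_semigroup :=
  NumericalSemigroup (generated_submonoid n) (generated_cofinite n).

Lemma prime_semigroup_gap1 n : gaps (prime_semigroup n) 1.
Proof.
have h : submonoid [set x | x != 1].
  by split => // x y /= /eqP x1 /eqP y1; apply/eqP; lia.
have sub : primes_from n `<=` [set x | x != 1] by move=> q [+ _] /=; case: eqP => // ->.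
by move=> /(_ [set x | x != 1] (conj h sub)).
Qed.

(* Main.v *)
Require Import Defs.
From mathcomp Require Import all_boot all_order all_algebra.
From mathcomp Require Import finmap zify boolp classical_sets cardinality.

(* Put p = p_n and c = f_n + 1; the claim is c <= e_n L, where L counts the
   elements of S_n below c. For odd p all primes in [p, 3p) are atoms, and
   3(p - 2) is a gap when p >= 5. If M primes lie in [p, 3p - 6], then
   M <= e_n, and adding multiples of 2p to these primes shows L >= 1 + i M as
   soon as c >= (2i + 1) p. Hence M (M + 1) >= 5p suffices, whatever the size of f_n.
   For p >= 26 this bound on M comes from the prime factorization of the
   central binomial coefficient (as in Erdos' proof of Bertrand's postulate)
   when p is large, and from counting primes otherwise. For p < 26 it can
   fail, and sums of two primes must be counted in L as well. *)

Set Implicit Arguments.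
Unset Strict Implicit.
Unset Printing Implicit Defensive.

Import GRing.Theory Num.Theory.
Local Open Scope classical_set_scope.
Local Open Scope nat_scope.

(** * Primes between p and 3p *)

Lemma leq_count_iota (a : pred nat) m n m' n' :
  m' <= m -> m + n <= m' + n' -> count a (iota m n) <= count a (iota m' n').
Proof.
move=> hm hn.
have -> : n' = (m - m') + (n + (m' + n' - (m + n))) by lia.
by rewrite !iotaD !count_cat subnKC // addnCA leq_addr.
Qed.

(** * The upper bound [4 ^ n] for primorials *)

Definition primorial n := \prod_(0 <= q < n.+1 | prime q) q.

Lemma prod_primes_dvd m n x :
  (forall q, prime q -> m <= q < n -> q %| x) ->
  \prod_(m <= q < n | prime q) q %| x.
Proof.
elim: n => [|n IH] hq; first by rewrite big_geq.
have [lemn|ltnm] := leqP m n; last by rewrite big_geq.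
have IHn : \prod_(m <= q < n | prime q) q %| x.
  by apply: IH => q pq /andP[h1 h2]; apply: hq => //; lia.
rewrite big_mkcond big_nat_recr //= -big_mkcond /=.
case: ifP => [pn|_]; last by rewrite muln1.
rewrite Gauss_dvd ?IHn ?hq //=; first by rewrite lemn /=.
rewrite coprime_sym prime_coprime // Euclid_dvd_prod // big_has_cond.
apply/negP => /hasP[q]; rewrite mem_index_iota => hqn /andP[pq].
rewrite dvdn_prime2 // => /eqP e; lia.
Qed.

(** The two equal middle coefficients both occur in the expansion of [(1 + 1) ^ (2 m + 1)]. *)
Lemma bin_odd_le m : 'C(m.*2.+1, m) <= 4 ^ m.
Proof.
rewrite -(leq_pmul2l (isT : 0 < 2)) (_ : 4 = 2 ^ 2) // -expnM -expnS mul2n mul2n.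
have -> : 2 ^ m.*2.+1 = \sum_(i < m.*2.+2) 'C(m.*2.+1, i).
  rewrite -[2]/(1 + 1) expnDn; apply: eq_bigr => i _.
  by rewrite !exp1n !muln1.
have h1 : m < m.*2.+2 by lia.
have h2 : m.+1 < m.*2.+2 by lia.
rewrite (bigD1 (Ordinal h1)) //= (bigD1 (Ordinal h2)) /=; last first.
  by rewrite -val_eqE /=; lia.
have -> : 'C(m.*2.+1, m.+1) = 'C(m.*2.+1, m).
  have lem : m <= m.*2.+1 by lia.
  by rewrite -(bin_sub lem) (_ : _ - _ = m.+1) //; lia.
by rewrite -addnn addnA leq_addr.
Qed.

Lemma prime_dvd_fact q n : prime q -> (q %| n`!) = (q <= n).
Proof.
move=> pq; apply/idP/idP => [|leqn]; last by rewrite dvdn_fact // prime_gt0.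
elim: n => [|n IH]; first by rewrite Euclid_dvd1.
rewrite factS Euclid_dvdM // => /orP[/dvdn_leq->//|/IH]; exact: leqW.
Qed.

(** A prime in [[m + 2, 2 m + 1]] divides [(2 m + 1)!] but neither [m!] nor [(m + 1)!], hence it
    divides the binomial coefficient. *)
Lemma primorial_odd m : primorial m.*2.+1 <= primorial m.+1 * 'C(m.*2.+1, m).
Proof.
rewrite /primorial (@big_cat_nat _ _ _ m.+2) //=; last lia.
rewrite leq_mul2l; apply/orP; right.
have lem : m <= m.*2.+1 by lia.
apply: dvdn_leq; first by rewrite bin_gt0.
apply: prod_primes_dvd => q pq hq.
have : q %| (m.*2.+1)`! by rewrite prime_dvd_fact //; lia.
rewrite -(bin_fact lem) !Euclid_dvdM // !prime_dvd_fact //.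
by case/or3P => //; lia.
Qed.

(** Strong induction: an even [n > 2] contributes no prime, and for [n = 2 m + 1] the bound splits
    as [4 ^ (m + 1)] for the primes up to [m + 1] times [4 ^ m] for the binomial coefficient. *)
Lemma primorial_le n : primorial n <= 4 ^ n.
Proof.
have [k] := ubnP n; elim: k n => // k IH n ltnk.
case: (boolP (odd n)) => [on|en]; last first.
  case: n ltnk en => [|[|[|n]]] // ltnk en.
  - by rewrite /primorial unlock.
  - by rewrite /primorial unlock.
  rewrite /primorial big_mkcond big_nat_recr //= -big_mkcond /=.
  case: ifP => [/even_prime[] // e|_].
    by move: en; rewrite e.
  rewrite muln1; apply: leq_trans (IH n.+2 _) _; first lia.
  by rewrite leq_exp2l.
have -> : n = n./2.*2.+1 by rewrite -[LHS]odd_double_half on.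
move: ltnk; rewrite -{1}[n]odd_double_half on; move: n./2 => m ltnk {on n}.
(* [m = 0] is separate, because [m + 1] is then not smaller than [2 m + 1]. *)
case: m ltnk => [|m] ltnk; first by rewrite /primorial unlock.
apply: leq_trans (primorial_odd _) _.
have -> : m.+1.*2.+1 = m.+2 + m.+1 by lia.
rewrite expnD; apply: leq_mul; first by apply: IH; lia.
by have := bin_odd_le m.+1; have -> : m.+1.*2.+1 = m.+2 + m.+1 by lia.
Qed.

(** * Prime factorization of the central binomial coefficient *)

(** From [k] to [k + 1] the right side grows by the factor [2 (2 k + 1) / k], which exceeds 4. *)
Lemma central_bin_ge n : 0 < n -> 4 ^ n <= n.*2 * 'C(n.*2, n).
Proof.
elim: n => // -[|k] IH _ //; have {}IH := IH isT; move: k.+1 IH => {}k IH.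
have e1 := mul_bin_diag k.+1.*2 k.
have e2 := mul_bin_down k.*2.+1 k.
move: IH e1 e2; rewrite expnS /= (_ : k.*2.+1 - k = k.+1); last lia.
rewrite doubleS /=.
move: 'C(_, _) => a; move: 'C(_, _) => b; move: 'C(_, _) => c; move: (4 ^ k) => x.
nia.
Qed.

(** Legendre's formula for the factorials in [(2 n)! = 'C(2 n, n) n! n!], with all sums brought to
    the same range. *)
Lemma logn_central_bin q n : prime q ->
  logn q 'C(n.*2, n) = \sum_(1 <= k < n.*2.+1) (n.*2 %/ q ^ k - (n %/ q ^ k).*2).
Proof.
move=> pq.
have len : n <= n.*2 by lia.
have /(congr1 (logn q)) := bin_fact len.
rewrite (_ : n.*2 - n = n); last lia.
rewrite !lognM ?muln_gt0 ?fact_gt0 ?bin_gt0 // !logn_fact //.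
have -> : \sum_(1 <= k < n.+1) n %/ q ^ k = \sum_(1 <= k < n.*2.+1) n %/ q ^ k.
  rewrite (@big_cat_nat _ _ _ n.+1 1 n.*2.+1) //=; try lia.
  rewrite [X in _ = _ + X]big_nat_cond [X in _ = _ + X]big1 ?addn0 // => i /andP[/andP[hi _] _].
  rewrite divn_small //; apply: leq_trans (ltn_expl i (prime_gt1 pq)); lia.
rewrite sumnB; last first.
  move=> i _; rewrite leq_divRL ?expn_gt0 ?prime_gt0 //.
  by rewrite -doubleMl leq_double leq_divM.
have -> : \sum_(1 <= i < n.*2.+1) (n %/ q ^ i).*2
   = (\sum_(1 <= i < n.*2.+1) n %/ q ^ i).*2.
  by rewrite -[RHS]muln2 big_distrl; apply: eq_bigr => i _ /=; rewrite muln2.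
lia.
Qed.

Lemma divn_double_sub m d : 0 < d ->
  m.*2 %/ d - (m %/ d).*2 <= (d <= m.*2).
Proof.
move=> d0; have [led|ltd] := leqP d m.*2; last by rewrite divn_small.
have h := divn_eq m d; have h' := ltn_pmod m d0.
have : m.*2 %/ d < (m %/ d).*2.+2 by rewrite ltn_divLR //; nia.
lia.
Qed.

(** Each Legendre term is at most 1 and vanishes once [q ^ k > 2 n], so the exponent is at most the
    integer logarithm of [2 n] to base [q]. *)
Lemma pfactor_central_bin_le q n : prime q -> 0 < n ->
  q ^ logn q 'C(n.*2, n) <= n.*2.
Proof.
move=> pq n0.
have hq := prime_gt1 pq.
apply: leq_trans (trunc_logP hq _); last by lia.
rewrite leq_exp2l // logn_central_bin //.
have lel : trunc_log q n.*2 <= n.*2.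
  have := trunc_logP hq (_ : 0 < n.*2).
  have := ltn_expl (trunc_log q n.*2) hq; lia.
apply: leq_trans (_ : \sum_(1 <= k < n.*2.+1) (k <= trunc_log q n.*2) <= _).
  apply: leq_sum => k _; apply: leq_trans (divn_double_sub _ _) _.
    by rewrite expn_gt0 prime_gt0.
  by case: (leqP (q ^ k) n.*2) => // h; rewrite trunc_log_max.
rewrite (@big_cat_nat _ _ _ (trunc_log q n.*2).+1) //=.
rewrite [X in _ + X]big_nat_cond [X in _ + X]big1; last by move=> i; lia.
rewrite addn0; apply: leq_trans (_ : \sum_(1 <= i < (trunc_log q n.*2).+1) 1 <= _).
  by apply: leq_sum => i _; exact: leq_b1.
by rewrite sum_nat_const_nat muln1 subn1.
Qed.

(* [n.*2 < q * q] leaves only the term [k = 1] of Legendre's formula. *)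
Lemma logn_central_bin_large q n : prime q -> n.*2 < q * q -> 0 < n ->
  logn q 'C(n.*2, n) = n.*2 %/ q - (n %/ q).*2.
Proof.
move=> pq hq n0; rewrite logn_central_bin // big_ltn; last lia.
rewrite expn1 big_nat_cond big1 ?addn0 // => k /andP[/andP[hk _] _].
apply/eqP; rewrite -leqn0; apply: leq_trans (divn_double_sub _ _) _.
  by rewrite expn_gt0 prime_gt0.
case: (leqP (q ^ k) n.*2) => // h.
have : q ^ 2 <= q ^ k by rewrite leq_exp2l // prime_gt1.
rewrite expnS expn1; lia.
Qed.

Lemma prod_if_const (P : pred nat) x m n :
  \prod_(m <= i < n) (if P i then x else 1) = x ^ count P (index_iota m n).
Proof. by rewrite -big_mkcond big_const_seq iter_muln_1. Qed.

Lemma prod_pfactor n N : 0 < n -> n < N -> n = \prod_(0 <= q < N) q ^ logn q n.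
Proof.
move=> n0 ltnN; case: N ltnN => // N ltnN.
by rewrite -{1}(partnT n0) (widen_partn (m := N)).
Qed.

(** Each [q <= s] contributes at most [2 n]; primes in [(s, 2 n / 3]] occur at most once; those in
    [(2 n / 3, n]] cancel, as [2 n %/ q = 2] and [n %/ q = 1]; each prime above [n] contributes at
    most [2 n]. *)
Lemma central_bin_le n s : 0 < n -> n.*2 < s.+1 * s.+1 ->
  'C(n.*2, n) <=
  n.*2 ^ s * primorial (n.*2 %/ 3) * n.*2 ^ count prime (iota n.+1 n).
Proof.
move=> n0 hs; set C := 'C(_, _).
have C0 : 0 < C by rewrite bin_gt0; lia.
have small q : prime q -> 0 < logn q C -> q <= n.*2.
  move=> pq lq; have := pfactor_central_bin_le pq n0; apply: leq_trans.
  by rewrite -/C -{1}[q]expn1 leq_exp2l // prime_gt1.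
pose a q := if 0 < q <= s then n.*2 else 1.
pose b q := if prime q && (q <= n.*2 %/ 3) then q else 1.
pose c q := if prime q && (n < q) then n.*2 else 1.
have a0 q : 0 < a q by rewrite /a; case: ifP; lia.
have b0 q : 0 < b q by rewrite /b; case: ifP => // /andP[/prime_gt0].
have c0 q : 0 < c q by rewrite /c; case: ifP; lia.
have abc q : q ^ logn q C <= a q * b q * c q.
  have abc0 : 0 < a q * b q * c q by rewrite !muln_gt0 a0 b0 c0.
  case: (boolP (prime q)) => [pq|/negPf npq]; last by rewrite /logn npq.
  have hle : q ^ logn q C <= n.*2 := pfactor_central_bin_le pq n0.
  have q0 := prime_gt0 pq.
  have [leqs|ltsq] := leqP q s.
    apply: leq_trans hle _; rewrite -mulnA -{1}[n.*2]muln1.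
    have -> : a q = n.*2 by rewrite /a q0 leqs.
    by rewrite leq_mul2l muln_gt0 b0 c0 orbT.
  have [leqn|ltnq] := leqP q n; last first.
    apply: leq_trans hle _; rewrite -{1}[n.*2]mul1n.
    have -> : c q = n.*2 by rewrite /c pq ltnq.
    by rewrite leq_mul2r muln_gt0 a0 b0 orbT.
  have hqq : n.*2 < q * q.
    by apply: leq_trans hs _; apply: leq_mul.
  have el : logn q C = n.*2 %/ q - (n %/ q).*2 by apply: logn_central_bin_large.
  have [leq3|lt3q] := leqP q (n.*2 %/ 3).
    have hb : b q = q by rewrite /b pq leq3.
    apply: leq_trans (_ : q ^ 1 <= _); last first.
      rewrite expn1 hb mulnAC -{1}[q]mul1n leq_mul2r muln_gt0 a0 c0 orbT //.
    rewrite leq_pexp2l // el.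
    by apply: leq_trans (divn_double_sub _ _) (leq_b1 _).
  have -> : logn q C = 0; last by rewrite expn0.
  have h1 : 0 < n %/ q by rewrite divn_gt0.
  have h2 : n.*2 %/ q < 3 by rewrite ltn_divLR //; move: lt3q; rewrite ltn_divLR //; lia.
  by rewrite el; lia.
(* The range must reach [C] for the factorization and [2 n] for the bound; factors beyond [2 n] are
   1. *)
have -> : C = \prod_(0 <= q < (maxn C n.*2).+1) q ^ logn q C.
  by apply: prod_pfactor => //; rewrite ltnS leq_maxl.
rewrite (@big_cat_nat _ _ _ n.*2.+1) //=; last by rewrite ltnS leq_maxr.
rewrite [X in _ * X]big_nat_cond [X in _ * X]big1 ?muln1; last first.
  move=> q /andP[/andP[hq _] _].
  case: (boolP (prime q)) => [pq|/negPf npq]; last by rewrite /logn npq.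
  have [->//|/(small q pq)] := posnP (logn q C); lia.
apply: leq_trans (_ : \prod_(0 <= q < n.*2.+1) (a q * b q * c q) <= _).
  by apply: leq_prod => q _.
rewrite !big_split /= !prod_if_const.
apply: leq_mul; first apply: leq_mul.
- rewrite leq_pexp2l //; first lia.
  rewrite -size_filter -[leqRHS](size_iota 1).
  apply: uniq_leq_size; first by rewrite filter_uniq // iota_uniq.
  by move=> x; rewrite mem_filter !mem_iota; lia.
- have len : n.*2 %/ 3 <= n.*2 by rewrite leq_div.
  rewrite (@big_cat_nat _ _ _ (n.*2 %/ 3).+1) //=.
  rewrite [X in _ * X]big_nat_cond [X in _ * X]big1 ?muln1; last first.
    by move=> q /andP[/andP[hq _] _]; rewrite /b ifN // negb_and -ltnNge hq orbT.
  rewrite /primorial [leqRHS]big_mkcond; apply/eq_leq/eq_big_nat => q /andP[_ hq].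
  by rewrite /b -ltnS hq andbT.
- rewrite leq_pexp2l //; first lia.
  rewrite -!size_filter.
  apply: uniq_leq_size; first by rewrite filter_uniq // iota_uniq.
  by move=> x; rewrite !mem_filter !mem_iota => /andP[/andP[-> h] h'] /=; lia.
Qed.

(* [4 ^ n <= 2 n 'C(2 n, n)], and a power [2 n ^ e] is at most [2 ^ (k e)]. *)
Lemma chebyshev_lower n s k : 0 < n -> n.*2 < s.+1 * s.+1 -> n.*2 <= 2 ^ k ->
  n.*2 <= 3 * (k * (s + count prime (iota n.+1 n)).+1).
Proof.
move=> n0 hs hk; set N := count _ _.
have := leq_trans (central_bin_ge n0) (leq_mul (leqnn n.*2) (central_bin_le n0 hs)).
rewrite -/N => h.
have {}h : 2 ^ n.*2 <= 2 ^ (k * (s + N).+1 + (n.*2 %/ 3).*2).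
  apply: leq_trans (leq_trans _ h) _; first by rewrite -mul2n expnM.
  have -> : n.*2 * (n.*2 ^ s * primorial (n.*2 %/ 3) * n.*2 ^ N)
     = n.*2 ^ (s + N).+1 * primorial (n.*2 %/ 3).
    by rewrite expnS expnD -[RHS]mulnA [in LHS]mulnAC.
  rewrite expnD; apply: leq_mul.
    by rewrite expnM leq_exp2r.
  by apply: leq_trans (primorial_le _) _; rewrite -[(_ %/ _).*2]mul2n expnM.
move: h; rewrite leq_exp2l // => h.
(* The primorial takes at most two thirds of the exponent [2 n]. *)
have := leq_divM n.*2 3; lia.
Qed.

(** * Enough primes in [[p, 3 p - 6]] *)

(** This is [25 k ^ 2 <= 2 ^ (k - 2)] from 15 on, shifted; it fails at 14. *)
Lemma exp2_square_bound k : 25 * (k + 15) ^ 2 <= 2 ^ (k + 13).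
Proof.
elim: k => [|k IH]; first by vm_compute.
rewrite [_ + 13]addSn [2 ^ _]expnS; apply: leq_trans (leq_mul (leqnn 2) IH).
by rewrite -!mulnn; lia.
Qed.

(** Let [t = s + N]. Too few primes would give [t ^ 2 <= 10.5 n + 23.4], while [chebyshev_lower]
    with [k ^ 2 <= n / 25] gives [(t + 1) ^ 2 >= 100 n / 9]. *)
Lemma many_primes_large n : 4900 <= n ->
  10 * n + 40 <= 3 * (count prime (iota n.+1 n) * (count prime (iota n.+1 n)).+1).
Proof.
move=> hn; set N := count _ _; rewrite leqNgt; apply/negP => hN.
have n0 : 0 < n by apply: leq_trans hn.
have [s hs1 hs2] : exists2 s, s * s <= n.*2 & n.*2 < s.+1 * s.+1.
  have ex : exists s, s * s <= n.*2 by exists 0.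
  have ub s : s * s <= n.*2 -> s <= n.*2 by nia.
  have [s hs max] := ex_maxnP ex ub; exists s => //.
  by rewrite ltnNge; apply/negP => /max; rewrite ltnn.
have n2 : 1 < n.*2 by lia.
have /= := up_log_bounds (isT : 1 < 2) n2; set k := up_log _ _ => /andP[hk1 hk2].
have := chebyshev_lower n0 hs2 hk2; rewrite -/N => hmain.
(* 4900 is [25 * 14 ^ 2], which settles [k <= 14]; beyond that, [2 ^ (k - 2) < n] is strong
   enough. *)
have hk : 25 * (k * k) <= n.
  have [lek|ltk] := leqP k 14.
    apply: leq_trans hn; apply: leq_trans (_ : 25 * (14 * 14) <= _); last by vm_compute.
    by rewrite leq_mul2l leq_mul.
  have := exp2_square_bound (k - 15).
  have -> : k - 15 + 15 = k by lia.
  have -> : k - 15 + 13 = k.-2 by lia.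
  move=> h; rewrite mulnn; apply: leq_trans h _.
  have : 2 ^ k.-1 = 2 * 2 ^ k.-2 by rewrite -expnS; congr (_ ^ _); lia.
  by move: hk1; lia.
have ht : 20 * ((s + N) * (s + N)) <= 210 * n + 468.
  (* The weights come from [(5 s - 4 N) ^ 2 >= 0]; 5/4 is close to [sqrt (5 / 3)], the ratio of the
     bounds for [N] and [s]. *)
  have : 20 * ((s + N) * (s + N)) <= 45 * (s * s) + 36 * (N * N).
    by have [+ _] := nat_Cauchy (5 * s) (4 * N); rewrite -!mulnn; clear; lia.
  by move: hN hs1; clear; lia.
move: hmain ht; move: (s + N) => t hmain ht.
have h1 : 100 * n <= 9 * (t.+1 * t.+1).
  have : n.*2 * n.*2 <= 3 * (k * t.+1) * (3 * (k * t.+1)) by apply: leq_mul.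
  have : 25 * (k * k) * (t.+1 * t.+1) <= n * (t.+1 * t.+1) by apply: leq_mul.
  move: n0; clear; nia.
have h2 : 50 * (t.+1 * t.+1) <= 51 * (t * t) + 2550.
  by have [+ _] := nat_Cauchy t 50; rewrite -!mulnn; clear; lia.
by move: hn ht h1 h2; clear; lia.
Qed.

(* The primes between [b] and [3 a - 6] lie in all intervals [p, 3 p - 6] with
   [a <= p <= b]. *)
Definition window_check (a b : nat) : bool :=
  let M := count prime (iota b (3 * a - 5 - b)) in 5 * b <= M * M.+1.

Lemma many_primes_window a b p : window_check a b -> a <= p <= b ->
  5 * p <= count prime (iota p (2 * p - 5)) * (count prime (iota p (2 * p - 5))).+1.
Proof.
move=> h /andP[leap lepb].
apply: leq_trans (leq_trans h _); first by rewrite leq_mul2l.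
have leM : count prime (iota b (3 * a - 5 - b)) <= count prime (iota p (2 * p - 5)).
  have [le|lt] := leqP b (3 * a - 5); first by apply: leq_count_iota; lia.
  by rewrite (_ : 3 * a - 5 - b = 0) //; lia.
by apply: leq_mul.
Qed.

Lemma many_primes p : 26 <= p ->
  5 * p <= count prime (iota p (2 * p - 5)) * (count prime (iota p (2 * p - 5))).+1.
Proof.
move=> hp; have [lep|ltp] := leqP p 4639; last first.
  (* For [n = (3 p - 7)./2], the interval [(n, 2 n]] lies in [[p, 3 p - 6]], and
     [10 n + 40 >= 15 p]. *)
  have hn : 4900 <= (3 * p - 7)./2 by lia.
  have := many_primes_large hn.
  have := @leq_count_iota prime (3 * p - 7)./2.+1 (3 * p - 7)./2 p (2 * p - 5).
  set N := count _ _; set M := count _ _ => leNM h.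
  have {}leNM : N <= M by apply: leNM; lia.
  have : N * N.+1 <= M * M.+1 by apply: leq_mul.
  by lia.
pose windows := [:: (26, 26); (27, 29); (30, 31); (32, 36); (37, 42); (43, 48);
  (49, 61); (62, 79); (80, 109); (110, 163); (164, 266); (267, 467); (468, 907);
  (908, 1973); (1974, 4639)].
have : has (fun ab : nat * nat => ab.1 <= p <= ab.2) windows by rewrite /=; lia.
have : all (fun ab => window_check ab.1 ab.2) windows by vm_compute.
move: windows => windows /allP hall /hasP[ab hab hpab].
exact: many_primes_window (hall _ hab) hpab.
Qed.

(** * A criterion for Wilf's inequality *)

(* [genus S / (frobenius S + 1) <= (embdim S - 1) / embdim S], multiplied out. *)
Definition wilf_inequality (S : numerical_semigroup) :=
  (frobenius S).+1 + embdim S * genus S <= embdim S * (frobenius S).+1.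

Lemma size_le_embdim (S : numerical_semigroup) (E : seq nat) :
  uniq E -> (forall x, x \in E -> atoms S x) -> size E <= embdim S.
Proof.
move=> uE hE; apply: uniq_leq_size => // x xE.
by rewrite in_fset_set; [exact/mem_set/hE | exact: finite_atoms].
Qed.

Lemma genus_add_size_le (S : numerical_semigroup) (J : seq nat) :
  uniq J -> (forall x, x \in J -> ns_set S x /\ x <= frobenius S) ->
  genus S + size J <= (frobenius S).+1.
Proof.
move=> uJ hJ.
have mem x : (x \in enum_fset (fset_set (gaps S))) = (x \in gaps S).
  by rewrite in_fset_set //; exact: finite_gaps.
rewrite /genus -size_cat -[leqRHS](size_iota 0); apply: uniq_leq_size.
  rewrite cat_uniq fset_uniq uJ andbT /=; apply/hasPn => x /hJ[Sx _].
  by rewrite /= mem; apply/negP => /set_mem.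
move=> x; rewrite mem_cat mem mem_iota /= add0n ltnS => /orP[/set_mem|/hJ[]//].
exact: gap_le_frobenius.
Qed.

(** The translates [K + 2 j p] with [j < i] lie in the disjoint intervals
    [[(2 j + 1) p, (2 j + 3) p)], and 0 is one more element; [maxn 1] keeps 0 below the bound even
    when [p = 0]. *)
Lemma translates_exist (S : numerical_semigroup) p (K : seq nat) i :
  ns_set S p -> uniq K -> (forall x, x \in K -> ns_set S x /\ p <= x < 3 * p) ->
  exists J, [/\ uniq J, size J = (i * size K).+1 &
                forall x, x \in J -> ns_set S x /\ x < maxn 1 ((2 * i).+1 * p)].
Proof.
have [S0 SD] := ns_submonoid S.
move=> Sp uK hK; elim: i => [|i [J [uJ sJ hJ]]].
  by exists [:: 0]; split => // x; rewrite inE => /eqP->; split; [|lia].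
have Smul j : ns_set S (j * p) by elim: j => // j IH; rewrite mulSn; exact: SD.
exists (J ++ [seq x + (2 * i) * p | x <- K]); split.
- rewrite cat_uniq uJ map_inj_uniq ?uK ?andbT /=; last by move=> x y /addIn.
  apply/hasPn => _ /mapP[x /hK[_ hx] ->]; apply/negP => /hJ[_]; nia.
- by rewrite size_cat sJ size_map; lia.
- move=> x; rewrite mem_cat => /orP[/hJ[Sx hx]|/mapP[y /hK[Sy hy] ->]].
    by split => //; lia.
  by split; [exact: SD | nia].
Qed.

(* Since [p] is in [S], translating [K] by multiples of [2 p] yields
   [1 + i |K|] elements of [S] below [(2 i + 1) p]. *)
Lemma wilf_criterion (S : numerical_semigroup) p g0 (E K : seq nat) :
  0 < p -> ns_set S p -> gaps S g0 ->
  uniq E -> (forall x, x \in E -> atoms S x) ->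
  uniq K -> (forall x, x \in K -> ns_set S x /\ p <= x < 3 * p) ->
  (forall c, g0 < c < 3 * p -> c <= size E * (count (fun x => x < c) K).+1) ->
  5 * p <= size E * (size K).+1 -> 2 * p <= size E * size K ->
  wilf_inequality S.
Proof.
rewrite /wilf_inequality => p0 Sp gg uE hE uK hK small h5 h2.
have leE := size_le_embdim uE hE.
suff [J [uJ hJ leJ]] : exists J : seq nat, [/\ uniq J,
    forall x, x \in J -> ns_set S x /\ x <= frobenius S &
    (frobenius S).+1 <= size E * size J].
  have := genus_add_size_le uJ hJ; nia.
have hg := gap_le_frobenius gg.
set c := (frobenius S).+1 in small *.
have [ltc|lec] := ltnP c (3 * p).
  exists (0 :: [seq x <- K | x < c]); split.
  - rewrite /= filter_uniq // mem_filter andbT; apply/negP => /andP[_ /hK]; lia.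
  - move=> x; rewrite inE mem_filter => /orP[/eqP->|/andP[ltx /hK[Sx _]]] //.
    by split => //; have [] := ns_submonoid S.
  - by rewrite /= size_filter; apply: small; rewrite ltc ltnS hg.
have [i i0 hi] : exists2 i, 0 < i & (2 * i).+1 * p <= c < (2 * i).+3 * p.
  exists ((c - p) %/ (2 * p)); first by rewrite divn_gt0; lia.
  have := divn_eq (c - p) (2 * p); have := ltn_pmod (c - p) (_ : 0 < 2 * p).
  move: (_ %/ _) (_ %% _); nia.
have [J [uJ sJ hJ]] := translates_exist i Sp uK hK.
exists J; split => //.
  by move=> x /hJ[Sx hx]; split => //; rewrite -ltnS -/c; nia.
(* It remains to bound [(2 i + 3) p]: [h5] is the case [i = 1], and [h2] pays the [2 p] of each
   further step. *)
rewrite sJ; case/andP: hi => _ /ltnW/leq_trans; apply.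
case: i i0 {sJ hJ} => // i _; nia.
Qed.

Lemma wilf_rat (g f e : nat) : f.+1 + e * g <= e * f.+1 ->
  (g%:R / (1 + f%:R) <= (e%:R - 1) / e%:R :> rat)%R.
Proof.
case: e => [|e] h; first by rewrite !mul0n in h.
rewrite nat1r ler_pdivrMr ?ltr0Sn // mulrAC ler_pdivlMr ?ltr0Sn //.
rewrite -natr1 addrK natr1 -!natrM ler_nat; lia.
Qed.

(** * The semigroups generated by primes *)

Lemma odd_prime_gt2 q : prime q -> 2 < q -> odd q.
Proof. by move=> /even_prime[->|]. Qed.

Lemma prime_nth_prime n : 0 < n -> prime (nth_prime n).
Proof.
case: n => // n _; rewrite /nth_prime iterS /next_prime.
by case: ex_minnP => p /andP[].
Qed.

Lemma prime_in_semigroup n q :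
  prime q -> nth_prime n <= q -> ns_set (prime_semigroup n) q.
Proof. by move=> pq leq A [_]; apply. Qed.

(* When [nth_prime n] is odd, the condition describes a submonoid containing all primes
   from [nth_prime n] on. *)
Lemma prime_semigroup_sub n x : 2 < nth_prime n -> ns_set (prime_semigroup n) x ->
  [\/ x = 0, prime x /\ nth_prime n <= x,
      ~~ odd x /\ 2 * nth_prime n <= x | 3 * nth_prime n <= x].
Proof.
set p := nth_prime n => p2.
pose A : set nat := [set x | [\/ x = 0, prime x /\ p <= x,
      ~~ odd x /\ 2 * p <= x | 3 * p <= x]].
move=> Sx; apply: (Sx A); split; last by move=> q [pq leq]; constructor 2.
split; first by constructor 1.
have odd_p q : prime q -> p <= q -> odd q.
  by move=> pq leq; apply: odd_prime_gt2 => //; exact: leq_trans leq.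
have ge z : A z -> z = 0 \/ p <= z by case; lia.
move=> y z [->|[py ley]|[ey ley]|ley] Az //; case: (Az) => [->|[pz lez]|[ez lez]|lez];
  rewrite ?addn0.
all: try by [constructor 1 | constructor 2 | constructor 3 | constructor 4; lia].
by constructor 3; have := odd_p _ py ley; have := odd_p _ pz lez; lia.
Qed.

(** If a sum of two nonzero elements is below [3 p], with [p = nth_prime n], both are below [2 p],
    hence odd primes, and their sum is even. *)
Lemma prime_semigroup_atom n q : 2 < nth_prime n -> prime q ->
  nth_prime n <= q < 3 * nth_prime n -> atoms (prime_semigroup n) q.
Proof.
move=> p2 pq /andP[leq ltq]; split.
  by split; [exact: prime_in_semigroup | have := prime_gt0 pq; case: (q)].
have odd_p r : prime r -> nth_prime n <= r -> odd r.
  by move=> pr ler; apply: odd_prime_gt2 => //; exact: leq_trans ler.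
move=> [x [/(prime_semigroup_sub p2) hx /= x0] [y [/(prime_semigroup_sub p2) hy /= y0] e]].
have oq := odd_p _ pq leq; subst q.
case: hx hy => [//|[px lex]|[ex lex]|lex] [//|[py ley]|[ey ley]|ley]; try lia.
have := odd_p _ px lex; have := odd_p _ py ley; lia.
Qed.

Lemma prime_semigroup_gap n x : 2 < nth_prime n -> 0 < x -> ~~ prime x ->
  ~~ odd x && (x < 2 * nth_prime n) || odd x && (x < 3 * nth_prime n) ->
  gaps (prime_semigroup n) x.
Proof.
move=> p2 x0 /negP npx hx /(prime_semigroup_sub p2) [|[]|[]|]; lia.
Qed.

(** * The criterion for [p >= 26] *)

Lemma wilf_large n : 1 <= n -> 26 <= nth_prime n ->
  wilf_inequality (prime_semigroup n).
Proof.
move=> n1 hp; have pp := prime_nth_prime n1.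
set p := nth_prime n in hp pp *.
have p2 : 2 < p by lia.
have op := odd_prime_gt2 pp p2.
pose E := [seq q <- iota p (2 * p - 5) | prime q].
have memE q : q \in E -> prime q /\ p <= q <= 3 * p - 6.
  by rewrite mem_filter mem_iota => /andP[-> h]; split => //; lia.
have uE : uniq E by rewrite filter_uniq // iota_uniq.
have h5 : 5 * p <= size E * (size E).+1.
  by have := many_primes hp; rewrite -size_filter.
apply: (@wilf_criterion _ p (3 * p - 6) E E) => //.
- lia.
- exact: prime_in_semigroup.
- apply: prime_semigroup_gap; rewrite // -/p; try lia.
  rewrite (_ : 3 * p - 6 = 3 * (p - 2)); last lia.
  apply/negP => /primeP[_ /(_ 3)]; rewrite dvdn_mulr // => /(_ isT); lia.
- by move=> q /memE[pq hq]; apply: prime_semigroup_atom => //; rewrite -/p; lia.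
- move=> q /memE[pq hq]; split; last lia.
  by apply: prime_in_semigroup => //; rewrite -/p; lia.
(* Since [c] exceeds the gap [3 p - 6], all of [E] lies below [c], and [h5] applies. *)
- move=> c hc.
  have -> : count (fun x => x < c) E = size E; last by lia.
  by apply/eqP; rewrite -all_count; apply/allP => q /memE[_ hq]; lia.
- nia.
Qed.

(** * The criterion for [p < 26] *)

Definition small_atoms p := [seq q <- iota p (2 * p) | prime q].

(** These are all nonzero elements of the semigroup below [3 p], since three generators already add
    up to at least [3 p]. *)
Definition small_elements p :=
  [seq x <- iota p (2 * p) |
    prime x || has (fun q => (x - q \in small_atoms p) && (q <= x)) (small_atoms p)].

Definition small_check p :=
  let E := small_atoms p in let K := small_elements p in
  [&& all (fun c => c <= size E * (count (fun x => x < c) K).+1)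
        (iota (2 * p - 1) (p + 1)),
      5 * p <= size E * (size K).+1 & 2 * p <= size E * size K].

Lemma wilf_small n : 1 <= n -> 2 < nth_prime n -> small_check (nth_prime n) ->
  wilf_inequality (prime_semigroup n).
Proof.
move=> n1 p2 /and3P[/allP hc h5 h2]; have pp := prime_nth_prime n1.
set p := nth_prime n in p2 hc h5 h2 pp *.
have memE q : q \in small_atoms p -> prime q /\ p <= q < 3 * p.
  by rewrite mem_filter mem_iota => /andP[-> h]; split => //; lia.
have SE q : q \in small_atoms p -> ns_set (prime_semigroup n) q.
  by move=> /memE[pq hq]; apply: prime_in_semigroup => //; rewrite -/p; lia.
(* The gap [2 p - 2] also serves [p = 3], where [3 p - 6 = p] is not a gap. *)
apply: (@wilf_criterion _ p (2 * p - 2) (small_atoms p) (small_elements p)) => //.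
- lia.
- exact: prime_in_semigroup.
- apply: prime_semigroup_gap; rewrite // -/p; try lia.
  by apply/negP => /even_prime[]; lia.
- by rewrite filter_uniq // iota_uniq.
- by move=> q /memE[pq hq]; apply: prime_semigroup_atom.
- by rewrite filter_uniq // iota_uniq.
- move=> x; rewrite mem_filter mem_iota => /andP[+ hx]; split; last by lia.
  case/orP: a => [px|/hasP[q qE /andP[xqE leqx]]].
    by apply: prime_in_semigroup => //; rewrite -/p; lia.
  have [_ SD] := ns_submonoid (prime_semigroup n).
  by rewrite -(subnKC leqx); apply: SD; apply: SE.
- by move=> c hgc; apply: hc; rewrite mem_iota; lia.
Qed.

(** Parity arguments fail for the generator 2; here 2 and 3 are atoms because 1 is a gap. *)
Lemma wilf_2 n : 1 <= n -> nth_prime n = 2 ->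
  wilf_inequality (prime_semigroup n).
Proof.
move=> n1 hp; set S := prime_semigroup n.
have [S0 SD] := ns_submonoid S.
have S2 : ns_set S 2 by apply: prime_in_semigroup; rewrite ?hp.
have S3 : ns_set S 3 by apply: prime_in_semigroup; rewrite ?hp.
have nS1 := @prime_semigroup_gap1 n.
have atom q : q \in [:: 2; 3] -> atoms S q.
  rewrite !inE => hq; split.
    by case/orP: hq => /eqP->; split.
  move=> [x [Sx /= x0] [y [Sy /= y0] e]].
  have x1 : x <> 1 by move=> e1; apply: nS1; rewrite -e1.
  have y1 : y <> 1 by move=> e1; apply: nS1; rewrite -e1.
  by case/orP: hq => /eqP; lia.
apply: (@wilf_criterion _ 2 1 [:: 2; 3] [:: 2; 3; 4; 5]) => //.
- move=> x; rewrite !inE => /or4P[] /eqP->; split => //.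
    by rewrite -[4]/(2 + 2); exact: SD.
  by rewrite -[5]/(2 + 3); exact: SD.
- by case=> [|[|[|[|[|[|]]]]]].
Qed.

Theorem proposition5 (n : nat) (hn : (1 <= n)%N) :
  ((genus (prime_semigroup n))%:R / (1 + (frobenius (prime_semigroup n))%:R)
   <= ((embdim (prime_semigroup n))%:R - 1) / (embdim (prime_semigroup n))%:R
   :> rat)%R.
Proof.
apply: wilf_rat.
have [hp|hp] := leqP 26 (nth_prime n); first exact: wilf_large.
have pp := prime_nth_prime hn.
have [p2|] := eqVneq (nth_prime n) 2; first exact: wilf_2.
move=> p2; have p3 : 2 < nth_prime n.
  by rewrite ltn_neqAle eq_sym p2 prime_gt1.
apply: wilf_small => //.
have : all (fun p => prime p ==> small_check p) (iota 3 23) by vm_compute.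
by move/allP/(_ (nth_prime n)); rewrite mem_iota pp; apply; lia.
Qed.
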